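(* Let $\mathbf u=\mathbf u(x)$ be a vector of dependent variables. The operator $\mathfrak I=D_x+\mathbf u\,D_x^{-1}\mathbf u^{\intercal}$ is symplectic.
   Context: $D_x$ is the total $x$-derivative and $D_x^{-1}$ its formal inverse, formally skew-adjoint, with integration constants zero; $\int\cdot\,dx$ is taken modulo total $x$-derivatives; $\langle\cdot,\cdot\rangle$ is the standard inner product. The operator acts on vectors $h$ (of the same size as $\mathbf u$) by $\mathfrak Ih=D_xh+\mathbf u\,D_x^{-1}(\langle\mathbf u,h\rangle)$. Its Fréchet derivative is $\mathfrak I'[h]=\frac{d}{d\epsilon}\big|_{\epsilon=0}\mathfrak I(\mathbf u+\epsilon h)$. Symplectic means that $\mathfrak I$ is formally skew-adjoint and $$\int\big(\langle\mathfrak I'[h_1]h_2,h_3\rangle+\langle\mathfrak I'[h_3]h_1,h_2\rangle+\langle\mathfrak I'[h_2]h_3,h_1\rangle\big)dx=0$$ for all $h_1,h_2,h_3$. *)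

(* Defs.v *)
From mathcomp Require Import all_boot all_order all_algebra.

Set Implicit Arguments.
Unset Strict Implicit.
Unset Printing Implicit Defensive.

Import Order.TTheory GRing.Theory Num.Theory.
Local Open Scope ring_scope.

(* The formal calculus of [D_x], [D_x^{-1}] and [\int . dx].

   [\int . dx] is taken modulo total derivatives, but a total derivative must
   not be allowed to be the derivative of an arbitrary nonlocal expression:
   since [D (Dinv f) = f], everything would then integrate to zero.  Hence two
   levels: the differential algebra [carrier] of all expressions, and the ideal
   [admissible] of those to which [Dinv] and [Int] apply; [Int] kills [D g] for
   [g] admissible, while [Dinv f] need not be admissible.  [Dinv] and [Int] are
   total functions whose values outside [admissible] are irrelevant.

   Examples.
   - carrier: smooth functions on the line all of whose derivatives have at
     most polynomial growth; admissible: Schwartz functions;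
     [Dinv f x = (\int_{-oo}^x f - \int_x^{+oo} f) / 2]; [Int f = \int f].
   - carrier: [R[t]] with [D t = 1 - t ^ 2]; admissible: multiples of
     [1 - t ^ 2]; [Dinv ((1 - t ^ 2) * q)]: the primitive [P] of [q] with
     [P(1) + P(-1) = 0]; [Int ((1 - t ^ 2) * q) = P(1) - P(-1)].
   In both, [Int f = 0] exactly when [f = D g] for some admissible [g]. *)
Record calculus (R : numFieldType) := Calculus {
  carrier : comAlgType R;
  D : {linear carrier -> carrier};
  D_Leibniz : forall f g, D (f * g) = D f * g + f * D g;

  admissible : {pred carrier};
  admissible0 : 0 \in admissible;
  admissible_ideal :
    forall a f g, f \in admissible -> g \in admissible ->
      a * f + g \in admissible;
  admissibleD : forall f, f \in admissible -> D f \in admissible;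

  Dinv : carrier -> carrier;
  Dinv_linear :
    forall (c : R) f g, f \in admissible -> g \in admissible ->
      Dinv (c *: f + g) = c *: Dinv f + Dinv g;
  DinvK : forall f, f \in admissible -> D (Dinv f) = f;
  (* The integration constants are zero. *)
  DK : forall f, f \in admissible -> Dinv (D f) = f;

  int_space : lmodType R;
  Int : carrier -> int_space;
  Int_linear :
    forall (c : R) f g, f \in admissible -> g \in admissible ->
      Int (c *: f + g) = c *: Int f + Int g;
  Int_D : forall g, g \in admissible -> Int (D g) = 0;
  Dinv_skew :
    forall f g, f \in admissible -> g \in admissible ->
      Int (f * Dinv g) = - Int (Dinv f * g)
}.

Arguments D {R} _.
Arguments admissible {R} _.
Arguments Dinv {R} _.
Arguments Int {R} _.

Section Operators.
Variables (R : numFieldType) (C : calculus R) (n : nat).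
Local Notation A := (carrier C).
Local Notation vec := 'cV[A]_n.

Definition dot (a b : vec) : A := \sum_i a i 0 * b i 0.

Definition admissible_vec (h : vec) : Prop :=
  forall i, h i 0 \in admissible C.

(* [d] is [d/deps Phi(u + eps h)] at [eps = 0], for a map [Phi] whose values
   along the line [u + eps h] are polynomial in the scalar [eps], with
   coefficients in [carrier C]; it is then unique (see below). *)
Definition frechet_derivative (Phi : vec -> vec) (u h d : vec) : Prop :=
  exists p : 'I_n -> {poly A},
    (forall (eps : R) i, Phi (u + eps%:A *: h) i 0 = (p i).[eps%:A])
    /\ (forall i, d i 0 = (p i)^`().[0]).

Definition formally_skew_adjoint (L : vec -> vec) : Prop :=
  forall h1 h2, admissible_vec h1 -> admissible_vec h2 ->
    Int C (dot (L h1) h2) = - Int C (dot h1 (L h2)).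

(* [J u] is the operator with coefficients evaluated at [u]; [dJ h] is its
   Frechet derivative [J'[h]].  The test vectors are admissible, the analogue
   of variations vanishing at infinity; [u] itself need not be. *)
Definition symplectic (J : vec -> vec -> vec) : Prop :=
  forall u : vec,
    formally_skew_adjoint (J u) /\
    exists dJ : vec -> vec -> vec,
      (forall h k, admissible_vec h -> admissible_vec k ->
         frechet_derivative (fun v => J v k) u h (dJ h k)) /\
      (forall h1 h2 h3,
         admissible_vec h1 -> admissible_vec h2 -> admissible_vec h3 ->
         Int C (dot (dJ h1 h2) h3 + dot (dJ h3 h1) h2 + dot (dJ h2 h3) h1)
         = 0).

(* h |-> (D_x + u D_x^{-1} u^T) h *)
Definition opI (u h : vec) : vec :=
  map_mx (D C) h + Dinv C (dot u h) *: u.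

Lemma poly_eq0_scalars (p : {poly A}) :
  (forall eps : R, p.[eps%:A] = 0) -> p = 0.
Proof.
move=> p0.
have H m (q : {poly A}) : (size q <= m)%N ->
    (forall k, (k < m)%N -> q.[(k%:R : R)%:A] = 0) -> q = 0.
  elim: m q => [|m IH] q sq q0; first by apply/eqP; rewrite -size_poly_leq0.
  have /factor_theorem[r qE] : root q (m%:R : R)%:A by apply/eqP/q0.
  suff r0 : r = 0 by rewrite qE r0 mul0r.
  apply: IH => [|k km].
    have [->|r_neq0] := eqVneq r 0; first by rewrite size_poly0.
    by move: sq; rewrite qE size_Mmonic ?monicXsubC // size_XsubC addn2.
  have := q0 k (ltnW km); rewrite qE hornerM hornerXsubC -scalerBl.
  rewrite -scalerAr mulr1 => /(congr1 (fun x => (k%:R - m%:R)^-1 *: x)).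
  rewrite scaler0 scalerA mulVf ?scale1r // subr_eq0 eqr_nat.
  by rewrite neq_ltn km.
by apply: (H (size p)).
Qed.

Lemma frechet_derivative_unique (Phi : vec -> vec) (u h d d' : vec) :
  frechet_derivative Phi u h d -> frechet_derivative Phi u h d' -> d = d'.
Proof.
move=> [p [pE dE]] [q [qE d'E]]; apply/colP => i; rewrite dE d'E.
suff -> : p i = q i by [].
apply/subr0_eq/poly_eq0_scalars => eps.
by rewrite hornerD hornerN -pE -qE subrr.
Qed.

End Operators.

(* Main.v *)
Require Import Defs.
From mathcomp Require Import all_boot all_order all_algebra.
From mathcomp Require Import ring.

(** Write [P = Dinv].  Everything reduces to one fact, [integrates_to0_Dinv]: since
    [P] is skew-adjoint, [P f * g + P g * f] integrates to zero for admissible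
    [f] and [g].

    Skew-adjointness: in [<I h1, h2> + <h1, I h2>] the [D]-terms add up to the
    total derivative of [<h1, h2>], and the nonlocal terms are
    [P f * g + P g * f] with [f = <u, h1>] and [g = <u, h2>].

    Closedness: along the line [u + eps h] the operator is quadratic in [eps],
    with linear coefficient [I'[h] k = P <h, k> u + P <u, k> h].  Hence
    [<I'[h1] h2, h3> = P <h1, h2> <u, h3> + P <u, h2> <h1, h3>], and the six
    terms of the cyclic sum group into three such sums, one for each
    [{f, g} = {<hi, hj>, <u, hk>}].

    For arbitrary [u] all these integrals make sense because [u] occurs under
    [P] and [Int] only in products with a component of a test vector, and the
    admissible elements form an ideal. *)

Set Implicit Arguments.
Unset Strict Implicit.
Unset Printing Implicit Defensive.

Import GRing.Theory.
Local Open Scope ring_scope.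

Section Symplectic.
Variables (R : numFieldType) (C : calculus R) (n : nat).
Local Notation A := (carrier C).
Local Notation vec := 'cV[A]_n.
Implicit Types (f g : A) (u v h k : vec).

Lemma admissible_add f g :
  f \in admissible C -> g \in admissible C -> f + g \in admissible C.
Proof. by move=> ? ?; rewrite -[f]mul1r; apply: admissible_ideal. Qed.

Lemma admissible_mulr f g : g \in admissible C -> f * g \in admissible C.
Proof.
by move=> ?; rewrite -[_ * _]addr0; apply: admissible_ideal => //; apply: admissible0.
Qed.

Lemma Int_add f g : f \in admissible C -> g \in admissible C ->
  Int C (f + g) = Int C f + Int C g.
Proof. by move=> ? ?; rewrite -[f]scale1r Int_linear // !scale1r. Qed.

(** Carrying admissibility along with the vanishing of the integral makes the
    predicate stable under addition, as [Int] is additive only on admissible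
    elements. *)
Definition integrates_to0 f := f \in admissible C /\ Int C f = 0.

Lemma integrates_to0_add f g :
  integrates_to0 f -> integrates_to0 g -> integrates_to0 (f + g).
Proof.
move=> [fA f0] [gA g0]; split; first exact: admissible_add.
by rewrite Int_add // f0 g0 addr0.
Qed.

Lemma integrates_to0_D f : f \in admissible C -> integrates_to0 (D C f).
Proof. by move=> fA; split; [apply: admissibleD | apply: Int_D]. Qed.

(** Skew-adjointness of [Dinv], in the symmetric form in which the nonlocal
    terms occur below. *)
Lemma integrates_to0_Dinv f g : f \in admissible C -> g \in admissible C ->
  integrates_to0 (Dinv C f * g + Dinv C g * f).
Proof.
move=> fA gA; split; first by apply: admissible_add; apply: admissible_mulr.
rewrite Int_add ?admissible_mulr //.
by rewrite [Dinv C g * f]mulrC Dinv_skew // subrr.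
Qed.

Lemma dotC u v : dot u v = dot v u.
Proof. by apply: eq_bigr => i _; rewrite mulrC. Qed.

Lemma dotDl u v h : dot (u + v) h = dot u h + dot v h.
Proof. by rewrite -big_split; apply: eq_bigr => i _; rewrite mxE mulrDl. Qed.

Lemma dotZl f u h : dot (f *: u) h = f * dot u h.
Proof. by rewrite mulr_sumr; apply: eq_bigr => i _; rewrite mxE mulrA. Qed.

Lemma admissible_dot u h : admissible_vec h -> dot u h \in admissible C.
Proof.
move=> hA; apply: (big_ind (fun f => f \in admissible C)).
- exact: admissible0.
- exact: admissible_add.
- by move=> i _; apply: admissible_mulr.
Qed.

Lemma D_dot h k :
  D C (dot h k) = dot (map_mx (D C) h) k + dot (map_mx (D C) k) h.
Proof.
rewrite raddf_sum -big_split; apply: eq_bigr => i _ /=.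
by rewrite D_Leibniz !mxE [h i 0 * _]mulrC.
Qed.

Lemma opI_skew u : formally_skew_adjoint (@opI R C n u).
Proof.
move=> h1 h2 h1A h2A; apply/eqP; rewrite -addr_eq0; apply/eqP.
have DA h : admissible_vec h -> admissible_vec (map_mx (D C) h).
  by move=> hA i; rewrite mxE; apply: admissibleD.
rewrite [dot h1 _]dotC !dotDl !dotZl -Int_add; last 2 first.
- apply: admissible_add; first exact: admissible_dot.
  by apply/admissible_mulr/admissible_dot.
- apply: admissible_add; first by rewrite dotC; apply/admissible_dot/DA.
  by apply/admissible_mulr/admissible_dot.
rewrite addrACA -D_dot; apply: (integrates_to0_add _ _).2.
- exact/integrates_to0_D/admissible_dot.
- by apply: integrates_to0_Dinv; apply: admissible_dot.
Qed.

Definition dopI u h k : vec :=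
  Dinv C (dot h k) *: u + Dinv C (dot u k) *: h.

Lemma dopI_frechet u h k : admissible_vec k ->
  frechet_derivative (fun v => opI v k) u h (dopI u h k).
Proof.
move=> kA; pose a := Dinv C (dot u k); pose b := Dinv C (dot h k).
(* The coefficients of [D k + (a + eps b) (u + eps h)] in powers of [eps]. *)
exists (fun i => (D C (k i 0) + a * u i 0)%:P
                 + (b * u i 0 + a * h i 0)%:P * 'X + (b * h i 0)%:P * 'X^2).
split=> [eps i|i].
  have DinvE : Dinv C (dot (u + eps%:A *: h) k) = a + eps%:A * b.
    rewrite dotDl dotZl !mulr_algl ![_ + eps *: _]addrC.
    by rewrite Dinv_linear ?admissible_dot.
  by rewrite /opI DinvE !mxE !hornerE /=; ring.
by rewrite !derivE !mxE !hornerE.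
Qed.

Lemma dopI_cyclic u h1 h2 h3 :
  admissible_vec h1 -> admissible_vec h2 -> admissible_vec h3 ->
  Int C (dot (dopI u h1 h2) h3 + dot (dopI u h3 h1) h2
         + dot (dopI u h2 h3) h1) = 0.
Proof.
move=> h1A h2A h3A.
have pair h k v : admissible_vec h -> admissible_vec k -> admissible_vec v ->
    integrates_to0 (Dinv C (dot h k) * dot u v + Dinv C (dot u v) * dot h k).
  by move=> hA kA vA; apply: integrates_to0_Dinv; apply: admissible_dot.
have [_ <-] := integrates_to0_add (integrates_to0_add
  (pair _ _ _ h1A h2A h3A) (pair _ _ _ h3A h1A h2A)) (pair _ _ _ h2A h3A h1A).
congr (Int C _); rewrite !dotDl !dotZl.
by rewrite [dot h1 h3]dotC [dot h3 h2]dotC [dot h2 h1]dotC; ring.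
Qed.

End Symplectic.

Theorem proposition1 (R : numFieldType) (C : calculus R) (n : nat) :
  symplectic (@opI R C n).
Proof.
move=> u; split; first exact: opI_skew.
exists (dopI u); split=> [h k _|]; first exact: dopI_frechet.
exact: dopI_cyclic.
Qed.
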